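(* Let $\lambda_1,\lambda_2\ge0$ and $\vec\lambda=(\lambda_1,\lambda_2)$. Let $\mathfrak M=(\mathcal M,\rho)$ be a pseudometric space, and let $F:\mathcal M\to\mathrm{Conv}(\mathbf R^2)$ be a set-valued mapping. Suppose that either $\mathcal M$ is finite or there exist a constant $\alpha\ge0$ and elements $\bar x_1,\dots,\bar x_m\in\mathcal M$ such that the set $\bigcap\{F(\bar x_k)+\alpha Q_0:k=1,\dots,m\}$ is non-empty and bounded. If the $\vec\lambda$-Projection Algorithm produces the outcome ''No go'', then there does not exist a Lipschitz selection of $F$ with Lipschitz seminorm at most $\min\{\lambda_1,\lambda_2\}$. Otherwise, the $\vec\lambda$-Projection Algorithm produces the outcome ''Success'' and returns the mapping $f_{\vec\lambda;F}:\mathcal M\to\mathbf R^2$, which has the following properties: ($\bigstar A$) The mapping $f_{\vec\lambda;F}$ is well defined, that is: (a) for every $x\in\mathcal M$, the set $F^{[1]}[x:\lambda_1]$ and the rectangle $\mathcal T^{[1]}_{F,\lambda_1}[x:\lambda_2]$ are non-empty; (b) the mapping $g_F$ is well defined; (c) for every $x\in\mathcal M$ the metric projection $\mathbf{Pr}(g_F(x),F^{[1]}[x:\lambda_1])$ is a singleton. ($\bigstar B$) $f_{\vec\lambda;F}$ is a Lipschitz selection of $F$ with $\|f_{\vec\lambda;F}\|_{\mathrm{Lip}(\mathcal M)}\le\lambda_1+2\lambda_2$.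
   Context: A pseudometric space $\mathfrak M=(\mathcal M,\rho)$ is a set with $\rho:\mathcal M\times\mathcal M\to[0,+\infty]$ such that $\rho(x,x)=0$, $\rho(x,y)=\rho(y,x)$, $\rho(x,y)\le\rho(x,z)+\rho(z,y)$; $\rho(x,y)=0$ with $x\ne y$ and $\rho(x,y)=+\infty$ are allowed. We read $\lambda\cdot(+\infty)=+\infty$ for every $\lambda\ge0$ and $(+\infty)Q_0=\mathbf R^2$. $\mathbf R^2$ carries the uniform norm $\|x\|=\max\{|x_1|,|x_2|\}$; $Q_0=[-1,1]^2$; sums of sets are Minkowski sums. $\mathrm{Conv}(\mathbf R^2)$ is the family of all non-empty convex closed subsets of $\mathbf R^2$. For $f:\mathcal M\to\mathbf R^2$, $\|f\|_{\mathrm{Lip}(\mathcal M)}=\inf\{\lambda\ge0:\|f(x)-f(y)\|\le\lambda\rho(x,y)\ \forall x,y\in\mathcal M\}$. A selection of $F$ is a map $f$ with $f(x)\in F(x)$ for all $x\in\mathcal M$. For a convex set $S\subset\mathbf R^2$, the rectangular hull $\mathcal H[S]$ is the smallest rectangle (product of two intervals, possibly unbounded and not necessarily closed, sides parallel to the axes) containing $S$, i.e., the product of its projections onto the coordinate axes. For a non-empty closed convex $S$ and $a\in\mathbf R^2$, $\mathbf{Pr}(a,S)$ is the set of points of $S$ nearest to $a$ in the uniform norm; when it is a singleton it is identified with its point. $S^{\mathrm{cl}}$ is the closure of $S$; $\mathrm{center}(S)$ is the center of a bounded centrally symmetric set $S$; $O=(0,0)$. The $\vec\lambda$-Projection Algorithm,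 applied to $F$ with $\vec\lambda=(\lambda_1,\lambda_2)$: Step 1. Form $F^{[1]}[x:\lambda_1]=\bigcap_{y\in\mathcal M}[F(y)+\lambda_1\rho(x,y)Q_0]$, $x\in\mathcal M$. If $F^{[1]}[x:\lambda_1]=\emptyset$ for some $x$, the outcome is ''No go'' and the algorithm stops. Step 2. Form $\mathcal T_{F,\lambda_1}(x)=\mathcal H[F^{[1]}[x:\lambda_1]]$, $x\in\mathcal M$. Step 3. Form $\mathcal T^{[1]}_{F,\lambda_1}[x:\lambda_2]=\bigcap_{y\in\mathcal M}[\mathcal T_{F,\lambda_1}(y)+\lambda_2\rho(x,y)Q_0]$, $x\in\mathcal M$. If this is empty for some $x$, the outcome is ''No go'' and the algorithm stops. Step 4. Put $g_F(x)=\mathrm{center}\big(\mathbf{Pr}(O,\mathcal T^{[1]}_{F,\lambda_1}[x:\lambda_2]^{\mathrm{cl}})\big)$, $x\in\mathcal M$. Step 5. Put $f_{\vec\lambda;F}(x)=\mathbf{Pr}(g_F(x),F^{[1]}[x:\lambda_1])$, $x\in\mathcal M$; the outcome is ''Success''. *)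

(* Defs.v *)
From HB Require Import structures.
From mathcomp Require Import all_boot all_order all_algebra.
From mathcomp Require Import all_classical all_reals all_analysis.
From mathcomp Require Import ring.

Set Implicit Arguments.
Unset Strict Implicit.
Unset Printing Implicit Defensive.

Import Order.TTheory GRing.Theory Num.Theory.
Import numFieldNormedType.Exports.
Local Open Scope classical_set_scope.
Local Open Scope ring_scope.

(* The plane is the product [R * R]: its norm in MathComp-Analysis is the
   uniform norm [max `|x.1| `|x.2|] (lemma [prod_normE]). *)

Definition is_pseudometric (R : realType) (M : Type) (rho : M -> M -> \bar R) :=
  [/\ forall x y, (0 <= rho x y)%E,
      forall x, rho x x = 0%E,
      forall x y, rho x y = rho y x
    & forall x y z, (rho x y <= rho x z + rho z y)%E].

Definition conv_family (R : realType) (S : set (R * R)) :=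
  [/\ S !=set0, convex_set S & closed S].

(* [l * r] with the convention [0 * +oo = +oo], unlike [mule].  The value at
   [-oo] is irrelevant, as distances are nonnegative. *)
Definition escale (R : realType) (l : R) (r : \bar R) : \bar R :=
  if r is r'%:E then (l * r')%:E else r.

Definition lip_constants (R : realType) (M : Type) (rho : M -> M -> \bar R)
    (f : M -> R * R) : set R :=
  [set l : R | 0 <= l /\
     forall x y, (`|f x - f y|%:E <= escale l (rho x y))%E].

Definition lip_seminorm (R : realType) (M : Type) (rho : M -> M -> \bar R)
    (f : M -> R * R) : \bar R :=
  ereal_inf (EFin @` lip_constants rho f).

Definition is_selection (R : realType) (M : Type) (F : M -> set (R * R))
    (f : M -> R * R) := forall x, F x (f x).

Definition lip_selection (R : realType) (M : Type) (rho : M -> M -> \bar R)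
    (F : M -> set (R * R)) (f : M -> R * R) :=
  is_selection F f /\ lip_constants rho f !=set0.

Definition unit_square (R : realType) : set (R * R) :=
  `[-1, 1]%classic `*` `[-1, 1]%classic.

Definition square (R : realType) (r : \bar R) : set (R * R) :=
  if r is r'%:E then [set r' *: q | q in @unit_square R] else setT.

Definition minkowski_sum (R : realType) (A B : set (R * R)) : set (R * R) :=
  [set a + b | a in A & b in B].

Definition rect_hull (R : realType) (S : set (R * R)) : set (R * R) :=
  (fst @` S) `*` (snd @` S).

Definition is_rectangle (R : realType) (Q : set (R * R)) :=
  exists A B : set R, [/\ is_interval A, is_interval B & Q = A `*` B].

Lemma convex_is_interval_img (R : realType) (S : set (R * R))
    (p : R * R -> R) :
  (forall t x y, p (t *: x + (1 - t) *: y) = t * p x + (1 - t) * p y) ->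
  convex_set S -> is_interval (p @` S).
Proof.
move=> pE cS _ _ [x Sx <-] [y Sy <-] z /andP[xz zy].
have [pxy|pxy] := eqVneq (p x) (p y).
  by exists x => //; apply/le_anti; rewrite xz pxy.
have d0 : 0 < p y - p x.
  by rewrite subr_gt0 lt_neqAle pxy (le_trans xz zy).
pose t := (p y - z) / (p y - p x).
have t0 : 0 <= t by apply: divr_ge0; [rewrite subr_ge0 | exact: ltW].
have t1 : t <= 1 by rewrite ler_pdivrMr ?mul1r ?lerD2l ?lerN2.
have := cS x y (Itv01 t0 t1) (mem_set Sx) (mem_set Sy); rewrite inE => Sxy.
exists (t *: x + (1 - t) *: y); first exact: Sxy.
rewrite pE /t; field; exact: lt0r_neq0.
Qed.

Lemma rect_hull_smallest (R : realType) (S : set (R * R)) : convex_set S ->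
  [/\ is_rectangle (rect_hull S), S `<=` rect_hull S &
      forall Q, is_rectangle Q -> S `<=` Q -> rect_hull S `<=` Q].
Proof.
move=> cS; split.
- exists (fst @` S), (snd @` S); split => //.
  + exact: convex_is_interval_img.
  + exact: convex_is_interval_img.
- by move=> x Sx; split; exists x.
- move=> _ [A [B [_ _ ->]]] SAB [_ _] [/= [x /SAB[Ax _] <-] [y /SAB[_ By] <-]].
  by split.
Qed.

Definition metric_proj (R : realType) (a : R * R) (S : set (R * R)) :
    set (R * R) :=
  [set p | S p /\ forall q, S q -> `|p - a| <= `|q - a|].

Definition symmetric_about (R : realType) (S : set (R * R)) (c : R * R) :=
  forall p, S p -> S (c *+ 2 - p).

(* [get] returns a default point when no such point exists, so [center] is
   meaningful only for sets satisfying [has_center]; likewise [proj_point]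
   requires the projection to be a singleton. *)
Definition center (R : realType) (S : set (R * R)) : R * R :=
  get [set c | symmetric_about S c].

Definition has_center (R : realType) (S : set (R * R)) :=
  [/\ S !=set0, bounded_set S & exists! c, symmetric_about S c].

Definition proj_point (R : realType) (a : R * R) (S : set (R * R)) : R * R :=
  get (metric_proj a S).

Section projection_algorithm.
Variables (R : realType) (M : Type) (rho : M -> M -> \bar R).
Implicit Types (F : M -> set (R * R)) (l : R) (x y : M).

Definition refinement F l x : set (R * R) :=
  \bigcap_y minkowski_sum (F y) (square (escale l (rho x y))).

Definition hull_map F l1 x : set (R * R) := rect_hull (refinement F l1 x).

Definition hull_refinement F l1 l2 x : set (R * R) :=
  refinement (hull_map F l1) l2 x.

Definition nearest_to_origin F l1 l2 x : set (R * R) :=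
  metric_proj 0 (closure (hull_refinement F l1 l2 x)).

Definition center_map F l1 l2 x : R * R := center (nearest_to_origin F l1 l2 x).

Definition projection_map F l1 l2 x : R * R :=
  proj_point (center_map F l1 l2 x) (refinement F l1 x).

Inductive outcome := NoGo | Success of (M -> R * R).

Definition projection_algorithm F l1 l2 : outcome :=
  if `[< exists x, refinement F l1 x = set0 >] then NoGo
  else if `[< exists x, hull_refinement F l1 l2 x = set0 >] then NoGo
  else Success (projection_map F l1 l2).

End projection_algorithm.

Arguments NoGo {R M}.

(* Main.v *)
Require Import Defs.
From HB Require Import structures.
From mathcomp Require Import all_boot all_order all_algebra.
From mathcomp Require Import all_classical all_reals all_analysis.
From mathcomp Require Import ring lra.

Import Order.TTheory GRing.Theory Num.Theory.
Import numFieldNormedType.Exports.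
Local Open Scope classical_set_scope.
Local Open Scope ring_scope.

Set Implicit Arguments.
Unset Strict Implicit.
Unset Printing Implicit Defensive.

(** If a selection has seminorm at most [min l1 l2], its value at [x] belongs to
    both intersections that the algorithm forms at [x], because the infimum
    defining the seminorm is attained; an empty intersection rules it out.

    When no set is empty, write [S x] for the refinement of [F] at [x], [g] for
    the center map and [f] for the projection map.  Three facts about the
    uniform norm carry the estimate.

    - The sets [T x] of the third step are rectangles, and coordinatewise they
      are intersections of enlarged intervals of the line.  Sliding a point of
      [T y] towards a point of [T x] shows that [T x] lies within
      [l2 * rho x y] of [T y] ([hull_refinement_dominated]).  The sets of points
      nearest to the origin are then boxes at the same Hausdorff distance, and
      their centers are as close ([center_close]): [g] is [l2]-Lipschitz, with
      values in the closure of the rectangular hull of [S x].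

    - If [a] lies in the closed rectangular hull of a convex set, a nearest
      point [p] must be a corner of the square around [a] that reaches it
      ([nearest_corner]): otherwise [p] is interior to a side of the square, and a
      short step towards a point of the set almost level with [a] brings it
      closer.  Midpoints of nearest points being nearest, there is only one.

    - If [a] lies in the closed rectangular hull of [\bigcap_i A i] and a square
      of positive radius around [a] misses the intersection, then it misses a single [A i]
      ([square_meets_bigcap]): in the vertical line through a suitable point
      this is the intersection property of intervals.  Moreover that [A i] lies
      entirely beyond the corner of the square that faces the nearest point
      ([member_beyond_corner]).

    The sets [S x] and [S y] are intersections of families whose members of
    equal index are within [r = l1 * rho x y] of each other, and [g x], [g y]
    are within [eps = l2 * rho x y].  Let [dA] and [dB] be the distances of
    [g x] and [g y] to these intersections.  By the third fact
    [|dA - dB| <= r + eps].  If the nearest points sit at corners of the same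
    orientation, they differ by at most [eps + |dA - dB|] in each coordinate,
    hence by at most [r + 2 * eps].  If the orientations differ, then even
    [dA + dB <= r + eps] ([distinct_corners]), which gives the same bound since
    the nearest points are within [dA + dB + eps] of each other. *)

(** * Betweenness and clamping on the line *)

Section Line.
Variable R : realType.
Implicit Types (A : set R) (a r x y z : R).

Definition between x y z := Num.min x y <= z <= Num.max x y.

Lemma le_between x y z : x <= z -> z <= y -> between x y z.
Proof. by move=> xz zy; rewrite /between ge_min xz le_max zy orbT. Qed.

Lemma betweenC x y z : between x y z = between y x z.
Proof. by rewrite /between minC maxC. Qed.

Lemma between_le x y z r : between x y z -> x <= r -> y <= r -> z <= r.
Proof.
by move=> /andP[_ zmax] xr yr; apply: le_trans zmax _; rewrite ge_max xr.
Qed.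

Lemma between_ge x y z r : between x y z -> r <= x -> r <= y -> r <= z.
Proof.
by move=> /andP[zmin _] rx ry; apply: le_trans zmin; rewrite le_min rx.
Qed.

Lemma between_dist x y z a r :
  between x y z -> `|x - a| <= r -> `|y - a| <= r -> `|z - a| <= r.
Proof.
move=> xyz; rewrite !ler_distl => /andP[x1 x2] /andP[y1 y2].
by rewrite (between_ge xyz) ?(between_le xyz).
Qed.

Lemma between_norm x y z r :
  between x y z -> `|x| <= r -> `|y| <= r -> `|z| <= r.
Proof. by move=> /(@between_dist _ _ _ 0 r); rewrite !subr0. Qed.

Lemma between_refl x z : between x x z -> z = x.
Proof. by rewrite /between minxx maxxx => zx; apply/esym/le_anti. Qed.

Lemma is_interval_between A x y z : is_interval A -> A x -> A y ->
  between x y z -> A z.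
Proof.
move=> iA Ax Ay; rewrite /between.
by case: (leP x y) => _; [exact: iA Ax Ay _|exact: iA Ay Ax _].
Qed.

(** Closures of rectangles are again rectangular because betweenness survives a
    small motion of the end points: [z] itself still serves, or the nearer of
    the new ends does. *)
Lemma between_approx (x y x' y' z e : R) : `|x - x'| < e -> `|y - y'| < e ->
  between x y z -> exists2 z', between x' y' z' & `|z - z'| < e.
Proof.
rewrite /between !ltr_norml => /andP[x1 x2] /andP[y1 y2] /andP[z1 z2].
have {z1} : x <= z \/ y <= z by move: z1; rewrite ge_min => /orP.
have {z2} : z <= x \/ z <= y by move: z2; rewrite le_max => /orP.
set m := Num.min x' y'; set k := Num.max x' y'.
have mk : m <= k by rewrite /m /k ge_min !le_max lexx.
have [m1 m2] : m <= x' /\ m <= y' by rewrite /m !ge_min !lexx orbT.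
have [k1 k2] : x' <= k /\ y' <= k by rewrite /k !le_max !lexx orbT.
have [m3|m3] : m = x' \/ m = y' by rewrite /m; case: (leP x' y') => _; [left|right].
all: have [k3|k3] : k = x' \/ k = y' by rewrite /k; case: (leP x' y') => _; [right|left].
all: move=> zxy xyz; have [zm|mz] := ltP z m;
  [exists m; rewrite ?lexx ?ltr_norml //; lra|].
all: have [kz|zk] := ltP k z; [exists k; rewrite ?lexx ?mk ?ltr_norml //; lra|].
all: exists z; rewrite ?mz ?zk // ltr_norml; lra.
Qed.

(** The point of the interval of radius [r] around [a] nearest to [x]. *)
Definition clamp a r x := Num.max (a - r) (Num.min (a + r) x).

Lemma clampP (a r x : R) : 0 <= r ->
  [/\ `|clamp a r x - a| <= r,
      forall y, y <= a + r -> y <= x -> y <= clamp a r x &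
      forall y, a - r <= y -> x <= y -> clamp a r x <= y].
Proof.
move=> r0; rewrite /clamp; split.
- by rewrite ler_distl le_max lexx ge_max ge_min lexx /=; lra.
- by move=> y y1 y2; rewrite le_max le_min y1 y2 orbT.
- by move=> y y1 y2; rewrite ge_max y1 ge_min y2 orbT.
Qed.

Lemma clamp_dist (a r d x : R) : 0 <= r -> 0 <= d -> `|x - a| <= d + r ->
  `|x - clamp a r x| <= d.
Proof.
move=> r0 d0; rewrite /clamp !ler_norml => /andP[h1 h2].
by case: (leP (a + r) x) => h; case: (leP (a - r)) => h'; lra.
Qed.

Lemma clamp_between (a r x z : R) : 0 <= r -> `|z - a| <= r ->
  between x z (clamp a r x).
Proof.
move=> r0; rewrite ler_distl => /andP[z1 z2]; have [_ lo hi] := clampP a x r0.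
rewrite /between; case: (leP x z) => xz.
  by apply/andP; split; [apply: lo|apply: hi]; lra.
by apply/andP; split; [apply: lo|apply: hi]; lra.
Qed.

End Line.

(** * The uniform norm and nearest points *)

Section UniformNorm.
Variable R : realType.
Implicit Types (S : set (R * R)) (a p q : R * R) (r : R).

Lemma norm_coordsP p r : `|p| <= r <-> `|p.1| <= r /\ `|p.2| <= r.
Proof. by rewrite prod_normE ge_max; split=> /andP. Qed.

Lemma norm_coords_ltP p r : `|p| < r <-> `|p.1| < r /\ `|p.2| < r.
Proof. by rewrite prod_normE gt_max; split=> /andP. Qed.

Lemma closure_approx S p r : closure S p -> 0 < r ->
  exists2 q, S q & `|p - q| < r.
Proof.
move=> clSp r0; have /clSp[q [Sq]] : nbhs p (ball p r) by exact: nbhsx_ballx.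
by rewrite -ball_normE; exists q.
Qed.

Lemma approx_closure S p :
  (forall r, 0 < r -> exists2 q, S q & `|p - q| < r) -> closure S p.
Proof.
move=> H B /nbhs_ballP[r /= r0 rB]; have [q Sq pq] := H r r0.
by exists q; split=> //; apply: rB; rewrite -ball_normE.
Qed.

Lemma compact_square a r :
  compact (`[a.1 - r, a.1 + r]%classic `*` `[a.2 - r, a.2 + r]%classic).
Proof. by apply: compact_setX; exact: segment_compact. Qed.

Lemma squareP a r p :
  (`[a.1 - r, a.1 + r]%classic `*` `[a.2 - r, a.2 + r]%classic) p <->
  `|p - a| <= r.
Proof.
split=> [[/=]|]; rewrite ?in_itv /=.
  by move=> p1 p2; apply/norm_coordsP => /=; rewrite !ler_distl; split; lra.
move=> /norm_coordsP[/=]; rewrite !ler_distl => p1 p2.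
by split; rewrite /= in_itv /=; lra.
Qed.

Lemma metric_proj_exists S a : closed S -> S !=set0 ->
  exists p, metric_proj a S p.
Proof.
move=> clS [s Ss].
set Q := (`[a.1 - `|s - a|, a.1 + `|s - a|]%classic `*`
          `[a.2 - `|s - a|, a.2 + `|s - a|]%classic).
have cK : compact (Q `&` S) by apply: compact_closedI => //; exact: compact_square.
have K0 : Q `&` S !=set0 by exists s; split => //; apply/squareP.
have [|p] := @compact_EVT_min _ _ (fun p : R * R => `|p - a|) _ K0 cK.
  apply: continuous_subspaceT => x; apply: cvg_norm; apply: cvgB; last exact: cvg_cst.
  exact: cvg_id.
rewrite inE => -[Qp Sp] pmin; exists p; split=> // q Sq.
have [qs|/ltW qs] := leP `|q - a| `|s - a|.
  by apply: pmin; rewrite inE; split=> //; apply/squareP.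
by apply: le_trans qs; apply/squareP.
Qed.

(** Compactness of squares removes the slack [e]; this is what makes Minkowski
    sums of closed sets with squares closed. *)
Lemma closed_attains S p r : closed S ->
  (forall e, 0 < e -> exists2 q, S q & `|p - q| <= r + e) ->
  exists2 q, S q & `|p - q| <= r.
Proof.
move=> clS H; have [q0 Sq0 _] := H 1 ltr01.
have [q [Sq qmin]] := metric_proj_exists p clS (ex_intro _ _ Sq0).
exists q => //; apply/ler_addgt0Pr => e /H[q1 Sq1 q1p].
by apply: le_trans q1p; rewrite distrC [leRHS]distrC; exact: qmin.
Qed.

Lemma convex_comb S (t : R) p q : convex_set S -> 0 <= t -> t <= 1 ->
  S p -> S q -> S (t *: p + (1 - t) *: q).
Proof.
by move=> cS t0 t1 Sp Sq; have := cS p q (Itv01 t0 t1) (mem_set Sp) (mem_set Sq); rewrite inE.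
Qed.

Lemma convex_bigcap (I : Type) (A : I -> set (R * R)) :
  (forall i, convex_set (A i)) -> convex_set (\bigcap_i A i).
Proof.
move=> cA p q t; rewrite !inE => Ap Aq i _.
by have := cA i p q t; rewrite !inE; apply; [exact: Ap|exact: Aq].
Qed.

End UniformNorm.

(** * Nearest points sit at corners of squares *)

Section Corners.
Variable R : realType.
Implicit Types (S : set (R * R)) (a p q : R * R) (u v : R * R -> R).

(** Statements about corners are made for a pair [u], [v] of affine functionals:
    taking for them the coordinates, up to sign and in either order, reduces the
    four corners of a square and the two axes to one situation. *)
Definition affine_fun u := forall (t : R) p q,
  u (t *: p + (1 - t) *: q) = t * u p + (1 - t) * u q.

Lemma affine_fst : affine_fun fst. Proof. by []. Qed.
Lemma affine_snd : affine_fun snd. Proof. by []. Qed.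

Lemma affine_signed (u : R * R -> R) (b : bool) (c : R) : affine_fun u ->
  affine_fun (fun p => (-1) ^+ b * (u p - c)).
Proof. by move=> uA t p q; rewrite uA; ring. Qed.

(** The intermediate value property on the segment from [p] to [q], stated so
    that the value of a second functional stays under control. *)
Lemma segment_level S u v p q (e : R) : convex_set S ->
  affine_fun u -> affine_fun v -> S p -> S q -> between (u p) (u q) e ->
  exists w, [/\ S w, u w = e & between (v p) (v q) (v w)].
Proof.
move=> cS uA vA; wlog pq : p q / u p <= u q => [wlg|] Sp Sq.
  have [pq|/ltW qp] := leP (u p) (u q); first exact: wlg.
  rewrite betweenC => qpe; have [w [Sw we vw]] := wlg q p qp Sq Sp qpe.
  by exists w; rewrite betweenC.
move=> pqe; have [upq|upq] := eqVneq (u p) (u q).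
  exists p; split=> //; first by apply/esym/between_refl; rewrite {2}upq.
  by rewrite /between ge_min le_max !lexx.
have pe : u p <= e by exact: between_ge pqe _ _.
have eq : e <= u q by exact: between_le pqe _ _.
have d0 : 0 < u q - u p by rewrite subr_gt0 lt_neqAle upq.
pose t := (e - u p) / (u q - u p).
have t0 : 0 <= t by apply: divr_ge0; [rewrite subr_ge0|exact: ltW].
have t1 : t <= 1 by rewrite ler_pdivrMr ?mul1r ?lerD2r.
exists (t *: q + (1 - t) *: p); split; first exact: convex_comb.
  by rewrite uA /t; field; exact: lt0r_neq0.
rewrite vA /between; case: (leP (v p) (v q)) => vpq; nra.
Qed.

(** Starting at [x] in the half-open interval [`]-d, d]`], a short step towards
    [y] lands in the open interval, unless it starts at [d] and does not
    decrease. *)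
Lemma inward_coord (x y d : R) : - d < x -> x <= d -> x < d \/ y < d ->
  exists t0 : R, [/\ 0 < t0, t0 <= 1 &
    forall t, 0 < t -> t <= t0 -> `|t * y + (1 - t) * x| < d].
Proof.
move=> dx xd xyd.
have small (k z : R) : 0 < k -> exists t0 : R, [/\ 0 < t0, t0 <= 1 &
    forall t, 0 < t -> t <= t0 -> t * `|z| < k].
  move=> k0; have D0 : 0 < k + `|z| + 1 by rewrite !ltr_wpDr // ?ltr_wpDr.
  exists (k / (k + `|z| + 1)); split; first exact: divr_gt0.
    by rewrite ler_pdivrMr // mul1r -addrA lerDl addr_ge0.
  move=> t t0; rewrite ler_pdivlMr // => H; have := normr_ge0 z => z0; nra.
have [tl [tl0 tl1 Hl]] := small (x + d) (y - x) ltac:(lra).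
have lower t : 0 < t -> t <= tl -> - d < t * y + (1 - t) * x.
  move=> t0 ttl; have := Hl t t0 ttl.
  have : - (y - x) <= `|y - x| by rewrite -normrN ler_norm.
  by move=> H1 H2; nra.
case: xyd => [xd'|yd].
  have [tu [tu0 tu1 Hu]] := small (d - x) (y - x) ltac:(lra).
  exists (Num.min tl tu); split; first by rewrite lt_min tl0.
    by rewrite ge_min tl1.
  move=> t t0; rewrite le_min => /andP[tl' tu']; rewrite ltr_norml lower //=.
  have := Hu t t0 tu'; have := ler_norm (y - x) => H1 H2; nra.
exists tl; split=> // t t0 ttl; rewrite ltr_norml lower //=.
have t1 := le_trans ttl tl1; nra.
Qed.

Lemma inward S u v (d : R) p w : convex_set S -> affine_fun u -> affine_fun v ->
  S p -> S w -> - d < u p -> u p <= d -> - d < v p -> v p <= d ->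
  u p < d \/ u w < d -> v p < d \/ v w < d ->
  exists2 q, S q & `|u q| < d /\ `|v q| < d.
Proof.
move=> cS uA vA Sp Sw up1 up2 vp1 vp2 ud vd.
have [t1 [t10 t11 H1]] := inward_coord up1 up2 ud.
have [t2 [t20 t21 H2]] := inward_coord vp1 vp2 vd.
have t0 : 0 < Num.min t1 t2 by rewrite lt_min t10.
exists (Num.min t1 t2 *: w + (1 - Num.min t1 t2) *: p).
  by apply: convex_comb => //; [exact: ltW|rewrite ge_min t11].
by rewrite uA vA; split; [apply: H1|apply: H2] => //; rewrite ge_min lexx ?orbT.
Qed.

(** The closure of the rectangular hull of [S], described by the two projections
    of [S]. *)
Definition near_hull S a := forall e : R, 0 < e ->
  (exists2 p, S p & `|p.1 - a.1| < e) /\ (exists2 p, S p & `|p.2 - a.2| < e).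

Lemma closure_rect_hull S a : closure (rect_hull S) a -> near_hull S a.
Proof.
move=> cla e e0.
have [c [/= [p Sp p1] [q Sq q2]] /norm_coords_ltP[/= c1 c2]] := closure_approx cla e0.
by split; [exists p|exists q]; rewrite // ?p1 ?q2 distrC.
Qed.

Lemma nearest_corner S a p : convex_set S -> near_hull S a ->
  metric_proj a S p -> `|p.1 - a.1| = `|p - a| /\ `|p.2 - a.2| = `|p - a|.
Proof.
move=> cS aS [Sp pmin].
set d := `|p - a|.
have /norm_coordsP[/= p1 p2] : `|p - a| <= d by [].
have away w : S w -> `|w.1 - a.1| < d -> `|w.2 - a.2| < d -> False.
  move=> Sw w1 w2; have := pmin _ Sw; rewrite leNgt => /negP; apply.
  exact/norm_coords_ltP.
(* If one coordinate of [p - a] were shorter than [d], moving [p] towards a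
   point of [S] on the line of [a] would shorten the other one. *)
have push (u v : R * R -> R) : affine_fun u -> affine_fun v ->
    (forall e : R, 0 < e -> exists2 w, S w & `|v w - v a| < e) ->
    (forall w, S w -> `|u w - u a| < d -> `|v w - v a| < d -> False) ->
    `|v p - v a| <= d -> `|u p - u a| < d -> `|v p - v a| < d.
  move=> uA vA vS away' vp up; rewrite ltNge; apply/negP => dv.
  have vd : `|v p - v a| = d by apply/le_anti; rewrite vp dv.
  have d0 : 0 < d by apply: le_lt_trans up.
  have [w Sw wd] := vS d d0.
  pose b := v p - v a < 0.
  have bv : (-1) ^+ b * (v p - v a) = d.
    by rewrite /b [X in _ * X]numEsign signrMK.
  have bw : (-1) ^+ b * (v w - v a) < d.
    by apply: le_lt_trans wd; rewrite -(normrMsign b); exact: ler_norm.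
  have [] := @inward S (fun p => (-1) ^+ false * (u p - u a))
    (fun p => (-1) ^+ b * (v p - v a)) d p w.
  - by [].
  - exact: affine_signed.
  - exact: affine_signed.
  - by [].
  - by [].
  - by rewrite mul1r; move: up; rewrite ltr_norml => /andP[].
  - by rewrite mul1r; move: up; rewrite ltr_norml => /andP[_ /ltW].
  - by rewrite bv; lra.
  - by rewrite bv.
  - by left; rewrite mul1r; move: up; rewrite ltr_norml => /andP[].
  - by right.
  move=> q Sq; rewrite !normrMsign; case; exact: away'.
have notboth : ~ (`|p.1 - a.1| < d /\ `|p.2 - a.2| < d) by case; exact: away.
split; apply/le_anti; rewrite ?p1 ?p2 /= leNgt; apply/negP => lt.
  apply: notboth; split=> //; apply: (push fst snd) => // e e0.
  by have [] := aS e e0.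
apply: notboth; split=> //; apply: (push snd fst) => //.
  by move=> e e0; have [] := aS e e0.
by move=> w Sw w2 w1; exact: away w1 w2.
Qed.

Lemma metric_proj_unique S a p q : convex_set S -> near_hull S a ->
  metric_proj a S p -> metric_proj a S q -> p = q.
Proof.
move=> cS aS pP qP; have [[Sp pmin] [Sq qmin]] := (pP, qP).
have pq : `|q - a| = `|p - a| by apply/le_anti; rewrite pmin // qmin.
pose m := 2^-1 *: p + (1 - 2^-1) *: q.
have Sm : S m by apply: convex_comb => //; lra.
have [p1 p2] := nearest_corner cS aS pP; have [q1 q2] := nearest_corner cS aS qP.
have mP : metric_proj a S m.
  split=> // w Sw; apply: le_trans (pmin w Sw).
  have -> : m - a = 2^-1 *: (p - a) + 2^-1 *: (q - a).
    by apply/pair_equal_spec; rewrite /m /=; split; rewrite /GRing.scale /=; field.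
  rewrite (le_trans (ler_normD _ _)) // !normrZ pq ger0_norm; lra.
have [m1 m2] := nearest_corner cS aS mP.
have mp : `|m - a| = `|p - a| by apply/le_anti; rewrite (mP.2 p) // pmin.
have coord (x y d : R) : `|x| = d -> `|y| = d -> `|2^-1 * x + 2^-1 * y| = d -> x = y.
  case: (ger0P x) => ?; case: (ger0P y) => ?;
  case: (ger0P (2^-1 * x + 2^-1 * y)) => ?; lra.
rewrite [p]surjective_pairing [q]surjective_pairing; congr pair.
  apply: (addIr (- a.1)); apply: (coord _ _ `|p - a|) => //; rewrite ?q1 //.
  by rewrite -mp -m1; congr (`|_|); rewrite /m /= /GRing.scale /=; field.
apply: (addIr (- a.2)); apply: (coord _ _ `|p - a|) => //; rewrite ?q2 //.
by rewrite -mp -m2; congr (`|_|); rewrite /m /= /GRing.scale /=; field.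
Qed.
End Corners.

(** * Intersections of convex sets and squares *)

Section NearestPointEstimate.
Variable R : realType.
Implicit Types (S : set (R * R)) (a p q w : R * R) (u v : R * R -> R).

(** The coordinate [u] relative to [a], reversed when [b] holds; the two bits
    [b1], [b2] used below name a corner of a square around [a]. *)
Definition signed_coord (b : bool) (u : R * R -> R) (a p : R * R) : R :=
  (-1) ^+ b * (u p - u a).

Lemma affine_signed_coord b u a : affine_fun u -> affine_fun (signed_coord b u a).
Proof. exact: affine_signed. Qed.

Lemma normr_signed_coord b u a p : `|signed_coord b u a p| = `|u p - u a|.
Proof. exact: normrMsign. Qed.

Lemma signed_coord_le b u a p : signed_coord b u a p <= `|u p - u a|.
Proof. by rewrite -(normr_signed_coord b) ler_norm. Qed.

Lemma signed_coord_norm u a p :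
  signed_coord (u p - u a < 0) u a p = `|u p - u a|.
Proof. by rewrite /signed_coord [X in _ * X]numEsign signrMK. Qed.

Lemma le_signed_coord b u a p c q : 
  signed_coord b u a p <= `|u p - u q| + `|u a - u c| + signed_coord b u c q.
Proof.
have : signed_coord b u a p - signed_coord b u c q <= `|(u p - u q) - (u a - u c)|.
  rewrite -(normrMsign b); apply: le_trans (ler_norm _).
  by rewrite /signed_coord; lra.
by have := ler_normB (u p - u q) (u a - u c); lra.
Qed.

Lemma signed_coordN b u a p : signed_coord (~~ b) u a p = - signed_coord b u a p.
Proof. by rewrite /signed_coord signrN mulNr. Qed.

Definition is_corner (d : R) (b1 b2 : bool) a p :=
  signed_coord b1 fst a p = d /\ signed_coord b2 snd a p = d.

Lemma nearest_is_corner S a p : convex_set S -> near_hull S a ->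
  metric_proj a S p -> exists b1 b2, is_corner `|p - a| b1 b2 a p.
Proof.
move=> cS aS /(nearest_corner cS aS)[p1 p2].
by exists (p.1 - a.1 < 0), (p.2 - a.2 < 0); split; rewrite signed_coord_norm.
Qed.

(** A point of [S] strictly below the corner in both coordinates would let [p]
    move into the interior of the square. *)
Lemma nearest_beyond_corner S a p (d : R) b1 b2 w : convex_set S ->
  metric_proj a S p -> d = `|p - a| -> 0 < d -> is_corner d b1 b2 a p -> S w ->
  d <= signed_coord b1 fst a w \/ d <= signed_coord b2 snd a w.
Proof.
move=> cS [Sp pmin] dE d0 [p1 p2] Sw.
apply/orP; rewrite -[_ || _]negbK negb_or -!ltNge; apply/negP => /andP[w1 w2].
have [q Sq] : exists2 q, S q &
    `|signed_coord b1 fst a q| < d /\ `|signed_coord b2 snd a q| < d.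
  apply: (inward (p := p) (w := w)) => //; rewrite ?p1 ?p2 //; try lra.
  - exact: affine_signed_coord.
  - exact: affine_signed_coord.
rewrite !normr_signed_coord => qd; have := pmin _ Sq.
by rewrite leNgt -dE => /negP; apply; exact/norm_coords_ltP.
Qed.

(** A Helly-type theorem for arbitrary families.  The intersection has a point
    [x] in the vertical strip over the square and a point [y] in the horizontal
    one.  Let [e] be the abscissa in the strip nearest to that of [y].  The
    vertical line over [e] separates [y] from the points of the strip, so it
    meets [A i] at a height [g] within the square, and it meets the intersection
    at a height [h].  The height [f] in the square nearest to [h] lies between [h]
    and every such [g], so [(e, f)] belongs to every [A i]. *)
Lemma square_meets_bigcap (I : Type) (A : I -> set (R * R)) a (s : R) :
  0 <= s -> (forall i, convex_set (A i)) ->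
  (exists2 p, (\bigcap_i A i) p & `|p.1 - a.1| <= s) ->
  (exists2 p, (\bigcap_i A i) p & `|p.2 - a.2| <= s) ->
  (forall i, exists2 p, A i p & `|p - a| <= s) ->
  exists2 p, (\bigcap_i A i) p & `|p - a| <= s.
Proof.
move=> s0 cA [x Ax x1] [y Ay y2] near.
pose e := clamp a.1 s y.1; have [e1 _ _] := clampP a.1 y.1 s0.
have level T w : convex_set T -> T w -> T y -> `|w.1 - a.1| <= s ->
    exists2 h, T (e, h) & between y.2 w.2 h.
  move=> cT Tw Ty ws; have [z [Tz ze yz]] := segment_level cT (@affine_fst R)
    (@affine_snd R) Ty Tw (clamp_between y.1 s0 ws).
  by exists z.2; rewrite // -[e]ze -surjective_pairing.
have [h Sh _] := level _ x (convex_bigcap cA) Ax Ay x1.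
pose f := clamp a.2 s h; have [f2 _ _] := clampP a.2 h s0.
exists (e, f); last by apply/norm_coordsP.
move=> i _; have [w Aw /norm_coordsP[/= w1 w2]] := near i.
have [g Ag yg] := level (A i) w (cA i) Aw (Ay i Logic.I) w1.
have gs : `|g - a.2| <= s by exact: between_dist yg y2 w2.
have [z [Az zf zE]] := segment_level (cA i) (@affine_snd R) (@affine_fst R)
  (Sh i Logic.I) Ag (clamp_between h s0 gs).
by move: Az; rewrite [z]surjective_pairing zf (between_refl zE).
Qed.

(** The set contains a point [x] above the square and a point [y] to its right.
    If it also contained [w] below and to the left of the corner [(s, s)], then
    on the line [u = s] the segment from [x] to [y] would pass above the corner
    and the segment from [w] to [y] below it, so the corner itself would be in
    the set. *)
Lemma disjoint_beyond_corner S u v (s : R) x y w : convex_set S ->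
  affine_fun u -> affine_fun v -> 0 <= s ->
  (forall p, S p -> ~ (`|u p| <= s /\ `|v p| <= s)) ->
  S x -> u x <= s -> s < v x -> S y -> s < u y -> `|v y| <= s -> S w ->
  s < u w \/ s < v w.
Proof.
move=> cS uA vA s0 disj Sx ux vx Sy uy vy Sw.
apply/orP; rewrite -[_ || _]negbK negb_or -!leNgt; apply/negP => /andP[wu wv].
move: vy; rewrite ler_norml => /andP[vy1 vy2].
have [z [Sz zu zv]] := segment_level cS uA vA Sx Sy (le_between ux (ltW uy)).
have [z' [Sz' zu' zv']] := segment_level cS uA vA Sw Sy (le_between wu (ltW uy)).
have {}zv : s < v z.
  rewrite ltNge; apply/negP => vz; apply: (disj _ Sz).
  split; first by rewrite zu ger0_norm.
  rewrite ler_norml vz andbT; apply: (between_ge zv) => //; lra.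
have {}zv' : v z' <= s by exact: (between_le zv').
have [c [Sc cv cu]] := segment_level cS vA uA Sz' Sz (le_between zv' (ltW zv)).
rewrite zu zu' in cu.
by apply: (disj _ Sc); rewrite (between_refl cu) cv ger0_norm.
Qed.

(** Whereas [nearest_beyond_corner] confines the whole intersection, this
    confines a single member [A i], at the price of shrinking the square from
    radius [d] to [s].  Bounds on a single member pass to a neighbouring family;
    bounds on the intersection do not. *)
Lemma member_beyond_corner (I : Type) (A : I -> set (R * R)) a p d b1 b2 (s : R) :
  (forall i, convex_set (A i)) -> near_hull (\bigcap_i A i) a ->
  metric_proj a (\bigcap_i A i) p -> d = `|p - a| -> is_corner d b1 b2 a p ->
  0 < s -> s < d ->
  exists i, forall w, A i w ->
    s < signed_coord b1 fst a w \/ s < signed_coord b2 snd a w.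
Proof.
move=> cA aA pP dE cor s0 sd; have cS := convex_bigcap cA.
have [[x Ax x1] [y Ay y2]] := aA s s0.
have beyond w (Aw : (\bigcap_i A i) w) := nearest_beyond_corner cS pP dE (lt_trans s0 sd) cor Aw.
have /existsNP [i disj] : ~ forall i, exists2 w, A i w & `|w - a| <= s.
  move=> near; have [||w Aw ws] := square_meets_bigcap (ltW s0) cA _ _ near.
  - by exists x => //; exact: ltW.
  - by exists y => //; exact: ltW.
  by have := pP.2 _ Aw; rewrite leNgt -dE (le_lt_trans ws sd).
have bnd b u z : `|u z - u a| < s -> signed_coord b u a z < s.
  by apply: le_lt_trans; exact: signed_coord_le.
exists i => w Aw.
apply: (@disjoint_beyond_corner (A i) _ _ s x y) => //.
- exact: affine_signed_coord.
- exact: affine_signed_coord.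
- exact: ltW.
- move=> z Az; rewrite !normr_signed_coord => zs; apply: disj; exists z => //.
  exact/norm_coordsP.
- exact: Ax.
- by apply/ltW/bnd.
- by have [|] := beyond x Ax; have := bnd b1 fst x x1; lra.
- exact: Ay.
- by have [|] := beyond y Ay; have := bnd b2 snd y y2; lra.
- by rewrite normr_signed_coord; exact: ltW.
Qed.


(** * Nearest points of two close intersections *)

(** [S] lies beyond the corner [(s, s)].  On the segment from [x] to [x'] the
    point with [v = s] must therefore have [u > s], while [u] is at most [eta]
    at [x] and at most [eta + e] at [x']; this bounds the slope of the
    segment. *)
Lemma adjacent_corner_slope S u v (s eta e y y' : R) x x' : convex_set S ->
  affine_fun u -> affine_fun v -> (forall w, S w -> s < u w \/ s < v w) ->
  0 < eta -> eta < s -> 0 <= e -> S x -> S x' ->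
  u x <= eta -> v x = y -> s < y -> u x' <= eta + e -> v x' <= e - y' -> e - y' < s ->
  (s - eta) * y' < (e - (s - eta)) * y.
Proof.
move=> cS uA vA beyond eta0 etas e0 Sx Sx' ux vx sy ux' vx' y's.
have d0 : 0 < y - v x' by lra.
pose t := (y - s) / (y - v x').
have tE : t * (y - v x') = y - s by rewrite /t divfK // gt_eqF.
have t0 : 0 <= t by apply: divr_ge0; lra.
have t1 : t <= 1 by rewrite ler_pdivrMr // mul1r; lra.
have := beyond _ (convex_comb cS t0 t1 Sx' Sx); rewrite uA vA vx.
have -> : t * v x' + (1 - t) * y = y - t * (y - v x') by ring.
rewrite tE; case=> [su|]; last by lra.
have ste : s - eta < t * e by nra.
have : (s - eta) * (y - v x') < e * (y - s).
  by rewrite -tE mulrA [e * t]mulrC ltr_pM2r.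
nra.
Qed.

(** If [e <= S + S'], the two hypotheses give [S * y' < S' * y] and
    [S' * y < S * y']. *)
Lemma adjacent_slopes_sum (S S' e y y' : R) : 0 < y -> 0 < y' ->
  S * y' < (e - S) * y -> S' * y < (e - S') * y' -> S + S' < e.
Proof. by move=> y0 y'0 H H'; rewrite ltNge; apply/negP => le; nra. Qed.

Lemma between_pos (x y : R) : 0 <= x -> x < y ->
  exists s : R, [/\ 0 < s, x <= s & s < y].
Proof. by move=> x0 xy; exists ((x + y) / 2); split; lra. Qed.

Section TwoFamilies.
Variables (I : Type) (r eps : R).
Hypotheses (r0 : 0 <= r) (eps0 : 0 <= eps).

Definition within_dist (A B : I -> set (R * R)) :=
  forall i p, A i p -> exists2 q, B i q & `|p - q| <= r.

Definition nonexpansive u := forall p q, `|u p - u q| <= `|p - q|.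

Lemma signed_coord_transfer k u a b p q :
  nonexpansive u -> `|p - q| <= r -> `|a - b| <= eps ->
  signed_coord k u a q <= (r + eps) + signed_coord k u b p.
Proof.
move=> u1 pq ab; apply: le_trans (le_signed_coord k u a q b p) _.
rewrite lerD2r lerD //; first by rewrite (le_trans (u1 _ _)) // distrC.
exact: le_trans (u1 _ _) ab.
Qed.

Lemma fst_nonexpansive : nonexpansive fst.
Proof. by move=> p q; have /norm_coordsP[] : `|p - q| <= `|p - q| by []. Qed.

Lemma snd_nonexpansive : nonexpansive snd.
Proof. by move=> p q; have /norm_coordsP[] : `|p - q| <= `|p - q| by []. Qed.

Lemma le_norm_signed_coord b u a p :
  nonexpansive u -> signed_coord b u a p <= `|p - a|.
Proof.
by move=> u1; apply: le_trans (u1 _ _); exact: signed_coord_le.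
Qed.

Section OneSided.
Variables (A B : I -> set (R * R)) (a b : R * R).
Hypotheses (cA : forall i, convex_set (A i)) (BA : within_dist B A).
Hypotheses (ab : `|a - b| <= eps) (aA : near_hull (\bigcap_i A i) a).

(** Otherwise some [A i] lies beyond a corner so far from [a] that no point of it
    is within [r] of [q]. *)
Lemma dist_near p q : metric_proj a (\bigcap_i A i) p ->
  metric_proj b (\bigcap_i B i) q -> `|p - a| <= `|q - b| + (r + eps).
Proof.
move=> pP qP; rewrite leNgt; apply/negP => lt.
have [s [s0 qs sp]] : exists s : R, [/\ 0 < s, `|q - b| + (r + eps) <= s & s < `|p - a|].
  by apply: between_pos lt; rewrite !addr_ge0.
have [b1 [b2 cor]] := nearest_is_corner (convex_bigcap cA) aA pP.
have [i beyond] := member_beyond_corner cA aA pP erefl cor s0 sp.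
have [q' Aq' qq'] := BA (qP.1 i Logic.I).
have coord k (u : R * R -> R) (u1 : nonexpansive u) :
    signed_coord k u a q' <= s.
  apply: le_trans (signed_coord_transfer k u1 qq' ab) _; apply: le_trans qs.
  by rewrite addrC lerD2r le_norm_signed_coord.
have := coord b1 _ fst_nonexpansive; have := coord b2 _ snd_nonexpansive.
by have := beyond _ Aq'; lra.
Qed.

(** If the sum were larger, a point of [A i] within [r] of [q] could not be
    beyond the corner facing [p], since [q] lies on the other side of [b] in both coordinates. *)
Lemma opposite_corners p q b1 b2 :
  metric_proj a (\bigcap_i A i) p -> metric_proj b (\bigcap_i B i) q ->
  0 < `|p - a| -> is_corner `|p - a| b1 b2 a p ->
  is_corner `|q - b| (~~ b1) (~~ b2) b q -> `|p - a| + `|q - b| <= r + eps.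
Proof.
move=> pP qP p0 cor [q1 q2]; rewrite leNgt; apply/negP => lt.
have [s [s0 qs sp]] : exists s : R,
    [/\ 0 < s, Num.max 0 (r + eps - `|q - b|) <= s & s < `|p - a|].
  by apply: between_pos; rewrite ?le_max ?lexx // gt_max p0 ltrBlDr.
have [i beyond] := member_beyond_corner cA aA pP erefl cor s0 sp.
have [q' Aq' qq'] := BA (qP.1 i Logic.I).
move: qs; rewrite ge_max => /andP[_ qs].
have := signed_coord_transfer b1 fst_nonexpansive qq' ab.
have := signed_coord_transfer b2 snd_nonexpansive qq' ab.
move: q1 q2 (beyond _ Aq'); rewrite !signed_coordN => q1 q2 bq h1 h2.
by move: bq q1 q2; lra.
Qed.

(** One of two symmetric inequalities: [x] and [x'] are points of the two
    intersections almost in line with the centers, on opposite sides of them, and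
    their heights are compared through a point of [A i] within [r] of [x']. *)
Lemma adjacent_corner_half u v k m (s s' eta : R) x x' i :
  affine_fun u -> affine_fun v ->
  nonexpansive u -> nonexpansive v ->
  (forall w, A i w -> s < signed_coord k u a w \/ s < signed_coord m v a w) ->
  0 < eta -> eta < s -> r + eps < s + s' ->
  A i x -> B i x' -> `|u x - u a| < eta -> `|u x' - u b| < eta ->
  s < signed_coord m v a x -> s' < signed_coord (~~ m) v b x' ->
  (s - eta) * signed_coord (~~ m) v b x' <
    (r + eps - (s - eta)) * signed_coord m v a x.
Proof.
move=> uA vA u1 v1 beyond eta0 etas ss' Ax Bx' xa xb vx vx'.
have [x2 Ax2 xx2] := BA Bx'.
have h1 := signed_coord_transfer k u1 xx2 ab.
have h2 := signed_coord_transfer m v1 xx2 ab.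
have h3 : signed_coord k u b x' <= eta.
  by apply/ltW; apply: le_lt_trans xb; exact: signed_coord_le.
have h4 : signed_coord k u a x <= eta.
  by apply/ltW; apply: le_lt_trans xa; exact: signed_coord_le.
have h5 := signed_coordN m v b x'.
apply: (@adjacent_corner_slope (A i) (signed_coord k u a) (signed_coord m v a)
  s eta (r + eps) _ _ x x2) => //.
- exact: affine_signed_coord.
- exact: affine_signed_coord.
- exact: addr_ge0.
- lra.
- lra.
- lra.
Qed.

End OneSided.

Section BothSides.
Variables (A B : I -> set (R * R)) (a b : R * R).
Hypotheses (cA : forall i, convex_set (A i)) (cB : forall i, convex_set (B i)).
Hypotheses (AB : within_dist A B) (BA : within_dist B A).
Hypotheses (ab : `|a - b| <= eps).
Hypotheses (aA : near_hull (\bigcap_i A i) a) (bB : near_hull (\bigcap_i B i) b).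

(** The delicate case: the corners agree in the coordinate [u] and differ in [v].
    Neither family alone gives a contradiction; but the slope bounds obtained
    from the two families are reciprocal, and together they bound [dA + dB]. *)
Lemma adjacent_corners u v k m (dA dB : R) :
  affine_fun u -> affine_fun v ->
  nonexpansive u -> nonexpansive v ->
  (forall e : R, 0 < e -> exists2 x, (\bigcap_i A i) x & `|u x - u a| < e) ->
  (forall e : R, 0 < e -> exists2 x, (\bigcap_i B i) x & `|u x - u b| < e) ->
  (forall s : R, 0 < s -> s < dA -> exists i, forall w, A i w ->
    s < signed_coord k u a w \/ s < signed_coord m v a w) ->
  (forall s : R, 0 < s -> s < dB -> exists i, forall w, B i w ->
    s < signed_coord k u b w \/ s < signed_coord (~~ m) v b w) ->
  0 < dA -> 0 < dB -> dA + dB <= r + eps.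
Proof.
move=> uA vA u1 v1 stripA stripB beyondA beyondB dA0 dB0.
rewrite leNgt; apply/negP => lt.
(* The slope bounds hold with [S = dA - 2 * eta] and [S' = dB - 2 * eta], whose
   sum has to stay above [r + eps]. *)
have [eta [eta0 etaA etaB etae]] : exists eta : R,
    [/\ 0 < eta, 4 * eta < dA, 4 * eta < dB & 4 * eta < dA + dB - (r + eps)].
  set mn : R := Num.min dA (Num.min dB (dA + dB - (r + eps))).
  have mn0 : 0 < mn by rewrite !lt_min dA0 dB0 subr_gt0.
  have : mn <= mn by [].
  rewrite {2}/mn !le_min => /and3P[mA mB mS].
  by exists (mn / 8); split; lra.
have [||i bA] := beyondA (dA - eta); [lra|lra|].
have [||j bB'] := beyondB (dB - eta); [lra|lra|].
have [x Ax xa] := stripA _ eta0; have [x' Bx' xb] := stripB _ eta0.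
have bnd c z : `|u z - u c| < eta -> signed_coord k u c z < eta.
  by apply: le_lt_trans; exact: signed_coord_le.
have vx : dA - eta < signed_coord m v a x.
  by have := bnd _ _ xa; have := bA x (Ax i Logic.I); lra.
have vx' : dB - eta < signed_coord (~~ m) v b x'.
  by have := bnd _ _ xb; have := bB' x' (Bx' j Logic.I); lra.
have HA : (dA - eta - eta) * signed_coord (~~ m) v b x' <
    (r + eps - (dA - eta - eta)) * signed_coord m v a x.
  apply: (adjacent_corner_half (s' := dB - eta) cA BA ab uA vA u1 v1 bA _ _ _
    (Ax i Logic.I) (Bx' i Logic.I)) => //; lra.
have HB : (dB - eta - eta) * signed_coord m v a x <
    (r + eps - (dB - eta - eta)) * signed_coord (~~ m) v b x'.
  have ba : `|b - a| <= eps by rewrite distrC.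
  rewrite -{1}[m]negbK.
  apply: (adjacent_corner_half (s' := dA - eta) cB AB ba uA vA u1 v1 bB' _ _ _
    (Bx' j Logic.I) (Ax j Logic.I)) => //; rewrite ?negbK //; lra.
by have := adjacent_slopes_sum _ _ HA HB; lra.
Qed.

Lemma distinct_corners p q b1 b2 c1 c2 :
  metric_proj a (\bigcap_i A i) p -> metric_proj b (\bigcap_i B i) q ->
  0 < `|p - a| -> 0 < `|q - b| ->
  is_corner `|p - a| b1 b2 a p -> is_corner `|q - b| c1 c2 b q ->
  (b1, b2) <> (c1, c2) -> `|p - a| + `|q - b| <= r + eps.
Proof.
move=> pP qP p0 q0 corp corq neq.
have mA s := member_beyond_corner cA aA pP erefl corp (s := s).
have mB s := member_beyond_corner cB bB qP erefl corq (s := s).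
have [e1|n1] := eqVneq c1 b1.
  have e2 : c2 = ~~ b2 by move: e1 neq => ->; case: b2 {corp mA}; case: c2 {corq mB}.
  subst c1 c2.
  apply: (@adjacent_corners fst snd b1 b2 _ _ (@affine_fst R) (@affine_snd R)
    fst_nonexpansive snd_nonexpansive) => // e e0.
    by have [] := aA e0.
  by have [] := bB e0.
have {}e1 : c1 = ~~ b1 by move: n1; case: b1 {corp mA neq}; case: c1 {corq mB}.
subst c1.
have [e2|n2] := eqVneq c2 b2.
  subst c2.
  apply: (@adjacent_corners snd fst b2 b1 _ _ (@affine_snd R) (@affine_fst R)
    snd_nonexpansive fst_nonexpansive) => //.
  - by move=> e e0; have [] := aA e0.
  - by move=> e e0; have [] := bB e0.
  - by move=> s s0 sd; have [i H] := mA s s0 sd; exists i => w /H /or_comm.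
  - by move=> s s0 sd; have [i H] := mB s s0 sd; exists i => w /H /or_comm.
have {}e2 : c2 = ~~ b2 by move: n2; case: b2 {corp mA neq}; case: c2 {corq mB}.
by subst c2; exact: (opposite_corners cA BA ab aA pP qP p0 corp corq).
Qed.

(** With the corners of equal orientation the difference of the radii counts, by
    [dist_near]; in every other case their sum is at most [r + eps]. *)
Theorem nearest_points_close p q :
  metric_proj a (\bigcap_i A i) p -> metric_proj b (\bigcap_i B i) q ->
  `|p - q| <= r + 2 * eps.
Proof.
move=> pP qP.
have pq := dist_near cA BA ab aA pP qP.
have qp : `|q - b| <= `|p - a| + (r + eps).
  by apply: (dist_near cB AB _ bB qP pP); rewrite distrC.
have sum_le : `|p - a| + `|q - b| <= r + eps -> `|p - q| <= r + 2 * eps.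
  have -> : p - q = (p - a) - (q - b) + (a - b).
    by apply/pair_equal_spec; split; rewrite /=; ring.
  move=> H; apply: le_trans (ler_normD _ _) _.
  apply: le_trans (lerD (ler_normB _ _) ab) _; move: H; lra.
have [p0|p0] := eqVneq `|p - a| 0; first by apply: sum_le; lra.
have [q0|q0] := eqVneq `|q - b| 0; first by apply: sum_le; lra.
have [b1 [b2 corp]] := nearest_is_corner (convex_bigcap cA) aA pP.
have [c1 [c2 corq]] := nearest_is_corner (convex_bigcap cB) bB qP.
have [e|n] := pselect ((b1, b2) = (c1, c2)); last first.
  by apply: sum_le; apply: distinct_corners n => //; rewrite lt_def ?p0 ?q0 normr_ge0.
case: e => e1 e2; subst c1 c2; case: corp corq => p1 p2 [q1 q2].
have coord k u : nonexpansive u ->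
    signed_coord k u a p = `|p - a| -> signed_coord k u b q = `|q - b| ->
    `|u p - u q| <= r + 2 * eps.
  move=> u1 up uq.
  have h := le_trans (u1 a b) ab.
  have -> : `|u p - u q| = `|(`|p - a| - `|q - b|) + (-1) ^+ k * (u a - u b)|.
    by rewrite -(normrMsign k) -up -uq /signed_coord; congr `|_|; ring.
  rewrite (le_trans (ler_normD _ _)) // normrMsign.
  have : `| `|p - a| - `|q - b| | <= r + eps by rewrite ler_norml; lra.
  lra.
apply/norm_coordsP; split.
  exact: (coord b1 fst fst_nonexpansive).
exact: (coord b2 snd snd_nonexpansive).
Qed.

End BothSides.
End TwoFamilies.
End NearestPointEstimate.

(** * Minkowski sums with squares *)

Section Refinement.
Variable R : realType.
Implicit Types (S : set (R * R)) (p q w : R * R).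
Local Open Scope ereal_scope.

Lemma minkowski_squareP S (r : \bar R) p : 0 <= r ->
  minkowski_sum S (square r) p <-> exists2 w, S w & `|p - w|%:E <= r.
Proof.
case: r => [r| |] // r0; last first.
  split=> [[w Sw _]|[w Sw _]]; first by exists w; rewrite ?leey.
  by exists w => //; exists (p - w)%R; rewrite //= addrC subrK.
rewrite lee_fin in r0; split=> [[w Sw [_ [q [q1 q2] <-] <-]]|[w Sw]].
  exists w => //. rewrite lee_fin addrAC subrr add0r normrZ (ger0_norm r0).
  rewrite ler_piMr //; apply/norm_coordsP; rewrite !ler_norml.
  by move: q1 q2; rewrite /= !in_itv.
rewrite lee_fin => pw; exists w => //; exists (p - w)%R; last by rewrite addrC subrK.
have [r0'|r0'] := eqVneq r 0%R.
  exists 0%R; first by split; rewrite /= in_itv /=; lra.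
  by rewrite scaler0; apply/esym/eqP; rewrite -normr_le0 (le_trans pw) // r0'.
exists (r^-1 *: (p - w))%R; last by rewrite scalerA divff // scale1r.
have : (`|r^-1 *: (p - w)| <= 1)%R.
  by rewrite normrZ ger0_norm ?invr_ge0 // mulrC ler_pdivrMr ?mul1r // lt_def r0'.
by move=> /norm_coordsP[]; rewrite !ler_norml => h1 h2; split; rewrite /= in_itv.
Qed.

Lemma escale_ge0 (l : R) (r : \bar R) : (0 <= l)%R -> 0 <= r -> 0 <= escale l r.
Proof. by case: r => [r| |] //= l0; rewrite !lee_fin => r0; rewrite mulr_ge0. Qed.

Lemma escale_triangle (l d : R) (r r' : \bar R) : (0 <= l)%R -> 0 <= r' ->
  r <= d%:E + r' -> escale l r <= (l * d)%:E + escale l r'.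
Proof.
case: r' => [r'| |] // l0; last by rewrite /= addey ?leey.
case: r => [r| |] //; rewrite ?leNye // /escale -!EFinD !lee_fin -mulrDr => H.
exact: ler_wpM2l.
Qed.

Lemma minkowski_square_convex S (r : \bar R) : 0 <= r -> convex_set S ->
  convex_set (minkowski_sum S (square r)).
Proof.
move=> r0 cS p q t; rewrite !inE => /(minkowski_squareP _ _ r0)[w Sw pw].
move=> /(minkowski_squareP _ _ r0)[z Sz qz]; apply/(minkowski_squareP _ _ r0).
have [t0 t1] : (0 <= t%:num /\ t%:num <= 1 :> R)%R by split.
exists (t%:num *: w + (1 - t%:num) *: z)%R; first exact: convex_comb.
case: r {r0} pw qz => [r| |] //; rewrite ?leey // !lee_fin => pw qz.
have -> : (conv t p q - (t%:num *: w + (1 - t%:num) *: z) =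
  t%:num *: (p - w) + (1 - t%:num) *: (q - z))%R.
  rewrite -[conv t p q]/(t%:num *: p + (1 - t%:num) *: q)%R.
  by apply/pair_equal_spec; split; rewrite /= /GRing.scale /=; ring.
rewrite (le_trans (ler_normD _ _)) // !normrZ !ger0_norm ?subr_ge0 //.
have comb (s x y : R) : (0 <= s -> s <= 1 -> x <= r -> y <= r -> s * x + (1 - s) * y <= r)%R.
  by move=> *; nra.
exact: comb.
Qed.

Lemma minkowski_square_closed S (r : \bar R) : 0 <= r -> closed S ->
  closed (minkowski_sum S (square r)).
Proof.
move=> r0 clS p clp; apply/(minkowski_squareP _ _ r0).
have near (e : R) : (0 < e)%R -> exists2 q, minkowski_sum S (square r) q & (`|p - q| < e)%R.
  exact: closure_approx.
case: r r0 near {clp} => [r| |] // r0 near; last first.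
  by have [q /(minkowski_squareP _ _ r0)[w Sw _] _] := near 1%R ltr01; exists w; rewrite ?leey.
have [|w Sw pw] := @closed_attains _ S p r clS; last by exists w; rewrite ?lee_fin.
move=> e e0; have [q /(minkowski_squareP _ _ r0)[w Sw]] := near e e0.
rewrite lee_fin => qw pq; exists w => //.
have -> : (p - w = (p - q) + (q - w))%R by rewrite addrA subrK.
by rewrite (le_trans (ler_normD _ _)) // addrC lerD // ltW.
Qed.

Section Family.
Variables (M : Type) (rho : M -> M -> \bar R) (F : M -> set (R * R)) (l : R).
Hypotheses (rhoP : is_pseudometric rho) (l0 : (0 <= l)%R).

Lemma escale_rho_ge0 x y : 0 <= escale l (rho x y).
Proof. by case: rhoP => rho0 _ _ _; exact: escale_ge0. Qed.

Lemma refinementP x p : refinement rho F l x p <->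
  forall y, exists2 w, F y w & `|p - w|%:E <= escale l (rho x y).
Proof.
split=> H y; first by apply/minkowski_squareP; [exact: escale_rho_ge0|exact: H].
by move=> _; apply/minkowski_squareP; [exact: escale_rho_ge0|exact: H].
Qed.

Lemma refinement_sub x p : refinement rho F l x p -> F x p.
Proof.
move=> /refinementP /(_ x)[w Fw]; have [_ -> _ _] := rhoP.
by rewrite /= mulr0 lee_fin normr_le0 subr_eq0 => /eqP ->.
Qed.

(** By the triangle inequality a point near [F z] for the radius at [x] is near
    it for the radius at [y] plus [l * d]; clamping towards [F z] recovers the
    smaller radius. *)
Lemma enlargements_close x y (d : R) : (forall z, F z !=set0) ->
  rho x y = d%:E ->
  within_dist (l * d) (fun z => minkowski_sum (F z) (square (escale l (rho x z))))
    (fun z => minkowski_sum (F z) (square (escale l (rho y z)))).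
Proof.
move=> F0 xyd z p /(minkowski_squareP _ _ (escale_rho_ge0 _ _))[w Fw pw].
have [rho0 _ rhoC rhoD] := rhoP.
have d0 : (0 <= l * d)%R by rewrite mulr_ge0 // -lee_fin -xyd.
have := escale_triangle l0 (rho0 y z) (_ : rho x z <= d%:E + rho y z).
rewrite -xyd => /(_ (rhoD _ _ _)) tri.
have {pw tri} : `|p - w|%:E <= (l * d)%:E + escale l (rho y z) by exact: le_trans pw tri.
set s := escale _ _; have s0 : 0 <= s by exact: escale_rho_ge0.
case: s s0 => [s| |] // s0; last first.
  move=> _; exists p; last by rewrite subrr normr0.
  by apply/minkowski_squareP => //; exists w; rewrite ?leey.
rewrite -EFinD lee_fin => /norm_coordsP[/= pw1 pw2]; have sE := s0; rewrite lee_fin in s0.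
exists (clamp w.1 s p.1, clamp w.2 s p.2); last first.
  by apply/norm_coordsP; split; apply: clamp_dist; rewrite // addrC.
apply/(minkowski_squareP _ _ sE); exists w; rewrite // lee_fin.
apply/norm_coordsP; split.
  by have [] := clampP w.1 p.1 s0.
by have [] := clampP w.2 p.2 s0.
Qed.
End Family.
End Refinement.

(** * Rectangles, boxes and their centers *)

Section Centers.
Variable R : realType.
Implicit Types (K N : set (R * R)) (L U c p q w : R * R).

(** Rectangles recognised without naming their sides, so that the notion is
    transparent for closures and for intersections with squares. *)
Definition rectangular K := forall p q c, K p -> K q ->
  between p.1 q.1 c.1 -> between p.2 q.2 c.2 -> K c.

Lemma rectangle_rectangular K : is_rectangle K -> rectangular K.
Proof.
move=> [A [B [iA iB ->]]] p q c [/= Ap Bp] [/= Aq Bq] c1 c2.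
by split; [exact: is_interval_between c1|exact: is_interval_between c2].
Qed.

Lemma closure_rectangular K : rectangular K -> rectangular (closure K).
Proof.
move=> rK p q c clp clq c1 c2; apply: approx_closure => e e0.
have [p' Kp' /norm_coords_ltP[/= p1 p2]] := closure_approx clp e0.
have [q' Kq' /norm_coords_ltP[/= q1 q2]] := closure_approx clq e0.
have [z1 b1 cz1] := between_approx p1 q1 c1.
have [z2 b2 cz2] := between_approx p2 q2 c2.
by exists (z1, z2); [exact: (rK p' q')|apply/norm_coords_ltP].
Qed.

Definition box L U : set (R * R) :=
  [set p | L.1 <= p.1 <= U.1 /\ L.2 <= p.2 <= U.2].

Lemma compact_rectangular_box N : compact N -> N !=set0 -> rectangular N ->
  exists L U, [/\ L.1 <= U.1, L.2 <= U.2 & N = box L U].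
Proof.
move=> cN N0 rN.
have fstN (D : set (R * R)) : {within D, continuous (fst : R * R -> R)}.
  by apply: continuous_subspaceT => x; exact: cvg_fst.
have sndN (D : set (R * R)) : {within D, continuous (snd : R * R -> R)}.
  by apply: continuous_subspaceT => x; exact: cvg_snd.
have [p1 Np1 m1] := compact_EVT_min N0 cN (fstN N).
have [q1 Nq1 M1] := compact_EVT_max N0 cN (fstN N).
have [p2 Np2 m2] := compact_EVT_min N0 cN (sndN N).
have [q2 Nq2 M2] := compact_EVT_max N0 cN (sndN N).
rewrite !inE in Np1 Nq1 Np2 Nq2.
have corner p q : N p -> N q -> N (p.1, q.2).
  by move=> Np Nq; apply: (rN p q) => //=; rewrite /between ge_min le_max lexx ?orbT.
have NL := corner _ _ Np1 Np2; have NU := corner _ _ Nq1 Nq2.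
exists (p1.1, p2.2), (q1.1, q2.2); split=> /=.
- by apply: M1; rewrite inE.
- by apply: M2; rewrite inE.
apply/seteqP; split=> p.
  by move=> Np; split=> /=; rewrite ?m1 ?M1 ?m2 ?M2 ?inE.
move=> [/= /andP[l1 u1] /andP[l2 u2]].
by apply: (rN _ _ _ NL NU); exact: le_between.
Qed.

Lemma box_symmetric L U c : L.1 <= U.1 -> L.2 <= U.2 ->
  symmetric_about (box L U) c <-> c = 2^-1 *: (L + U).
Proof.
move=> LU1 LU2; split=> [sc|-> p [/= p1 p2]]; last first.
  by rewrite (mulr2n (2^-1 *: (L + U))); split; rewrite /= /GRing.scale /=; lra.
have [/= l1 l2] : box L U (c + c - L) by rewrite -mulr2n; apply: sc; split; lra.
have [/= u1 u2] : box L U (c + c - U) by rewrite -mulr2n; apply: sc; split; lra.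
rewrite [LHS]surjective_pairing [RHS]surjective_pairing /= /GRing.scale /=.
by congr pair; lra.
Qed.

Lemma center_box L U : L.1 <= U.1 -> L.2 <= U.2 ->
  Defs.center (box L U) = 2^-1 *: (L + U).
Proof.
move=> LU1 LU2; apply/(box_symmetric _ LU1 LU2).
apply: (@getPex _ [set c | symmetric_about (box L U) c]).
by exists (2^-1 *: (L + U)); apply/box_symmetric.
Qed.

Lemma has_center_compact N : compact N -> N !=set0 -> rectangular N ->
  has_center N.
Proof.
move=> cN N0 rN; split=> //; first exact: compact_bounded.
have [L [U [LU1 LU2 ->]]] := compact_rectangular_box cN N0 rN.
exists (2^-1 *: (L + U)); split; first by apply/box_symmetric.
by move=> c /(box_symmetric _ LU1 LU2).
Qed.

Lemma center_in N : compact N -> N !=set0 -> rectangular N -> N (Defs.center N).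
Proof.
move=> cN N0 rN; have [L [U [LU1 LU2 ->]]] := compact_rectangular_box cN N0 rN.
by rewrite center_box //; split; rewrite /= /GRing.scale /=; lra.
Qed.

(** One half of a Hausdorff distance bound. *)
Definition dominated_by (e : R) K K' :=
  forall p, K p -> exists2 q, K' q & `|p - q| <= e.

(** Domination applied to the two extreme corners compares the sides. *)
Lemma box_dominated L U L' U' (e : R) : L.1 <= U.1 -> L.2 <= U.2 ->
  dominated_by e (box L U) (box L' U') ->
  [/\ L'.1 <= L.1 + e, L'.2 <= L.2 + e, U.1 <= U'.1 + e & U.2 <= U'.2 + e].
Proof.
move=> LU1 LU2 dom.
have [|p [/= p1 p2] /norm_coordsP[/=]] := dom L; first by split; lra.
have [|q [/= q1 q2] /norm_coordsP[/=]] := dom U; first by split; lra.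
by rewrite !ler_norml => u1 u2 l1 l2; split; lra.
Qed.

Lemma center_close N N' (e : R) : compact N -> compact N' ->
  N !=set0 -> N' !=set0 -> rectangular N -> rectangular N' ->
  dominated_by e N N' -> dominated_by e N' N -> `|Defs.center N - Defs.center N'| <= e.
Proof.
move=> cN cN' N0 N'0 rN rN'.
have [L [U [LU1 LU2 ->]]] := compact_rectangular_box cN N0 rN.
have [L' [U' [LU'1 LU'2 ->]]] := compact_rectangular_box cN' N'0 rN'.
move=> /(box_dominated LU1 LU2)[a1 a2 a3 a4].
move=> /(box_dominated LU'1 LU'2)[b1 b2 b3 b4].
rewrite !center_box //; apply/norm_coordsP.
by split; rewrite /= /GRing.scale /= ler_norml; lra.
Qed.

Lemma nearest_to_0E K w : metric_proj 0 K w ->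
  metric_proj 0 K = K `&` [set p | `|p| <= `|w|].
Proof.
move=> [Kw wmin]; rewrite !subr0 in wmin.
apply/seteqP; split=> [p [Kp pmin]|p [Kp pw]]; split=> //.
  by have := pmin w Kw; rewrite !subr0.
by move=> q Kq; rewrite !subr0 (le_trans pw) // -[q]subr0 wmin.
Qed.

Lemma nearest_to_0_compact K : closed K -> K !=set0 -> compact (metric_proj 0 K).
Proof.
move=> clK K0; have [w wP] := metric_proj_exists 0 clK K0.
rewrite (nearest_to_0E wP) setIC; apply: compact_closedI => //.
have cQ := @compact_square R 0 `|w|; move: cQ; congr compact.
by apply/seteqP; split=> p; [move/squareP|move=> pw; apply/squareP]; rewrite subr0.
Qed.

Lemma nearest_to_0_rectangular K : closed K -> K !=set0 -> rectangular K ->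
  rectangular (metric_proj 0 K).
Proof.
move=> clK K0 rK; have [w wP] := metric_proj_exists 0 clK K0.
rewrite (nearest_to_0E wP).
move=> p q c [Kp /norm_coordsP[p1 p2]] [Kq /norm_coordsP[q1 q2]] c1 c2.
split; first exact: (rK p q).
by apply/norm_coordsP; split; [exact: between_norm c1 p1 q1|exact: between_norm c2 p2 q2].
Qed.

(** The distances of [K] and [K'] to the origin differ by at most [e].  A point of
    [K'] close to [p] may lie outside the square through the nearest point [w] of
    [K']; clamping it to that square moves it towards [w], hence inside [K'], and
    keeps it within [e] of [p]. *)
Lemma nearest_to_0_dominated K K' (e : R) : closed K' -> K' !=set0 ->
  rectangular K' -> 0 <= e -> dominated_by e K K' -> dominated_by e K' K ->
  dominated_by e (metric_proj 0 K) (metric_proj 0 K').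
Proof.
move=> clK' K'0 rK' e0 dom dom' p [Kp pmin].
have [w wP] := metric_proj_exists 0 clK' K'0; rewrite (nearest_to_0E wP).
have [k' Kk' pk'] := dom p Kp.
have pw : `|p| <= `|w| + e.
  have [k Kk wk] := dom' w wP.1; have := pmin k Kk; rewrite !subr0 => /le_trans; apply.
  have -> : k = w - (w - k) by rewrite opprB addrCA subrr addr0.
  by rewrite (le_trans (ler_normB _ _)) // lerD2l.
have w0 : 0 <= `|w| by [].
move: pk' pw => /norm_coordsP[/= pk1 pk2] /norm_coordsP[pw1 pw2].
have /norm_coordsP[w1 w2] : `|w| <= `|w| by [].
have coord (x y z : R) : `|x - y| <= e -> `|x| <= `|w| + e -> `|z| <= `|w| ->
    [/\ `|clamp 0 `|w| y| <= `|w|, between y z (clamp 0 `|w| y) &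
        `|x - clamp 0 `|w| y| <= e].
  move: (`|w|) w0 => r r0 xy xr zr; split.
  - by have [] := clampP 0 y r0; rewrite subr0.
  - by apply: clamp_between; rewrite // subr0.
  move: xy xr; rewrite /clamp !ler_norml.
  by case: (leP (0 + r) y) => ?; case: (leP (0 - r)) => ?; lra.
have [c1 b1 d1] := coord _ _ _ pk1 pw1 w1.
have [c2 b2 d2] := coord _ _ _ pk2 pw2 w2.
exists (clamp 0 `|w| k'.1, clamp 0 `|w| k'.2); last by apply/norm_coordsP.
by split; [apply: (rK' k' w) => //; exact: wP.1|apply/norm_coordsP].
Qed.

Lemma closure_dominated K K' (e : R) : dominated_by e K K' ->
  dominated_by e (closure K) (closure K').
Proof.
move=> dom p clp; apply: (closed_attains (S := closure K')); first exact: closed_closure.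
move=> d d0; have [q Kq pq] := closure_approx clp d0.
have [k Kk qk] := dom q Kq; exists k; first exact: subset_closure.
have -> : p - k = (q - k) + (p - q) by rewrite [RHS]addrC addrA subrK.
by rewrite (le_trans (ler_normD _ _)) // lerD // ltW.
Qed.

End Centers.

(** * Refinements of families of rectangles *)

Section HullRefinement.
Variables (R : realType) (M : Type) (rho : M -> M -> \bar R).
Variables (H : M -> set (R * R)) (l : R).
Hypotheses (rhoP : is_pseudometric rho) (l0 : 0 <= l).
Hypothesis (HR : forall z, is_rectangle (H z)).
Implicit Types (p q w : R * R) (x y z : M).

Definition near_line (A : set R) (r : \bar R) (t : R) :=
  exists2 a, A a & (`|t - a|%:E <= r)%E.

Lemma near_rectangleP (A B : set R) (r : \bar R) p :
  (exists2 w, (A `*` B) w & (`|p - w|%:E <= r)%E) <->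
  near_line A r p.1 /\ near_line B r p.2.
Proof.
have normP q : (`|q|%:E <= r)%E <-> (`|q.1|%:E <= r)%E /\ (`|q.2|%:E <= r)%E.
  by rewrite prod_normE EFin_max ge_max; split=> /andP.
split=> [[w [/= Aw Bw] /normP[h1 h2]]|[[a Aa ha] [b Bb hb]]].
  by split; [exists w.1|exists w.2].
by exists (a, b); [split|apply/normP].
Qed.

Lemma near_line_interval (A : set R) r : is_interval A ->
  is_interval (near_line A r).
Proof.
move=> iA s t [a Aa sa] [b Ab tb] z /andP[sz zt].
case: r sa tb => [r| |] //; last by exists a; rewrite ?leey.
rewrite !lee_fin => sa tb.
have r0 : 0 <= r by rewrite (le_trans _ sa).
have [az|az] := leP `|z - a| r; first by exists a; rewrite ?lee_fin.
have [bz|bz] := leP `|z - b| r; first by exists b; rewrite ?lee_fin.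
exists z; last by rewrite lee_fin subrr normr0.
have : a <= z <= b.
  move: sa tb az bz; rewrite !ler_norml !ltr_normr => /andP[? ?] /andP[? ?].
  by move=> /orP[?|?] /orP[?|?]; lra.
exact: iA.
Qed.

(** The enlarged intervals on the line: sliding [t] to within [d] of [s] keeps it
    in the enlargement of radius [r'], because that enlargement is an interval
    and contains [t] as well as a point within [d] of [s]. *)
Lemma near_line_slide (A : set R) (r r' : \bar R) (d s t : R) : is_interval A ->
  0 <= d -> (r <= d%:E + r')%E -> near_line A r s -> near_line A r' t ->
  near_line A r' (clamp s d t).
Proof.
move=> iA d0 rr' [a Aa sa] tA.
have {sa rr'} : (`|s - a|%:E <= d%:E + r')%E by exact: le_trans rr'.
have [b Ab tb] := tA.
case: r' tb tA => [r'| |] //; last by move=> *; exists b; rewrite ?leey.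
rewrite -EFinD !lee_fin => tb tA sa.
have r'0 : 0 <= r' by apply: le_trans tb.
have aA : near_line A r'%:E (clamp a r' s).
  by exists a; rewrite // lee_fin; have [] := clampP a s r'0.
have sa' := clamp_dist r'0 d0 sa.
set c := clamp a r' s in aA sa'.
apply: (is_interval_between (near_line_interval (r := r'%:E) iA) tA aA).
by apply: clamp_between; rewrite // distrC.
Qed.

Lemma hull_refinement_rectangle x : is_rectangle (refinement rho H l x).
Proof.
have HAB z : exists AB : set R * set R,
    [/\ is_interval AB.1, is_interval AB.2 & H z = AB.1 `*` AB.2].
  by have [A [B ?]] := HR z; exists (A, B).
have [AB ABP] := choice HAB.
exists [set t | forall z, near_line (AB z).1 (escale l (rho x z)) t].
exists [set t | forall z, near_line (AB z).2 (escale l (rho x z)) t]; split.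
- move=> s t hs ht c sct z; have [iA _ _] := ABP z.
  exact: near_line_interval iA _ _ (hs z) (ht z) _ sct.
- move=> s t hs ht c sct z; have [_ iB _] := ABP z.
  exact: near_line_interval iB _ _ (hs z) (ht z) _ sct.
apply/seteqP; split=> p.
  move=> /(refinementP _ rhoP l0) Hp; split=> z; have [_ _ HE] := ABP z;
    have := Hp z; rewrite HE => /near_rectangleP; tauto.
move=> [p1 p2]; apply/(refinementP _ rhoP l0) => z; have [_ _ ->] := ABP z.
by apply/near_rectangleP.
Qed.

(** A given point [w] of the refinement at [y] is slid towards [p] in each
    coordinate.  The result does not depend on the index [z], so a single point
    serves all the sets being intersected. *)
Lemma hull_refinement_dominated x y (d : R) :
  rho x y = d%:E -> refinement rho H l y !=set0 ->
  dominated_by (l * d) (refinement rho H l x) (refinement rho H l y).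
Proof.
move=> xyd [w /(refinementP _ rhoP l0) wy] p /(refinementP _ rhoP l0) px.
have [rho0 _ _ rhoD] := rhoP.
have d0 : 0 <= d by rewrite -lee_fin -xyd.
have ld0 : 0 <= l * d by rewrite mulr_ge0.
exists (clamp p.1 (l * d) w.1, clamp p.2 (l * d) w.2); last first.
  rewrite distrC; apply/norm_coordsP.
  by split; [have [] := clampP p.1 w.1 ld0|have [] := clampP p.2 w.2 ld0].
apply/(refinementP _ rhoP l0) => z.
have [A [B [iA iB HE]]] := HR z.
have tri : (escale l (rho x z) <= (l * d)%:E + escale l (rho y z))%E.
  by apply: escale_triangle => //; rewrite -xyd.
have := px z; have := wy z; rewrite HE => /near_rectangleP[w1 w2] /near_rectangleP[p1 p2].
by apply/near_rectangleP; split; [exact: near_line_slide p1 w1|exact: near_line_slide p2 w2].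
Qed.

End HullRefinement.

(** * The projection algorithm *)

Section Algorithm.
Variables (R : realType) (M : Type) (rho : M -> M -> \bar R).
Variables (F : M -> set (R * R)) (l1 l2 : R).
Hypotheses (rhoP : is_pseudometric rho) (l10 : 0 <= l1) (l20 : 0 <= l2).
Hypothesis (FP : forall x, conv_family (F x)).
Implicit Types x y z : M.

(** The infimum defining the seminorm is itself a Lipschitz constant. *)
Lemma lip_seminorm_bound (f : M -> R * R) (l : R) : 
  (lip_seminorm rho f <= l%:E)%E ->
  forall x y, (`|f x - f y|%:E <= escale l (rho x y))%E.
Proof.
move=> fl x y; have [rho0 _ _ _] := rhoP; have := rho0 x y.
case rxy : (rho x y) => [d| |] //; last by rewrite /= !leey.
rewrite !lee_fin => d0; apply/ler_addgt0Pr => e e0.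
have d1 : 0 < d + 1 by rewrite ltr_wpDl.
have /ereal_inf_lt[_ [l' [l'0 /(_ x y) fxy] <-] ll] :
    (lip_seminorm rho f < (l + e / (d + 1))%:E)%E.
  by apply: le_lt_trans fl _; rewrite lte_fin ltrDl divr_gt0.
rewrite rxy lee_fin in fxy; rewrite lte_fin in ll; apply: le_trans fxy _.
have : e / (d + 1) * d <= e by rewrite mulrAC ler_pdivrMr // ler_pM2l // lerDl ler01.
by move: ll d0; set k := e / (d + 1) => ll d0; nra.
Qed.

Lemma lip_selection_refines (f : M -> R * R) l (G : M -> set (R * R)) : 0 <= l ->
  is_selection G f -> (forall x y, (`|f x - f y|%:E <= escale l (rho x y))%E) ->
  is_selection (refinement rho G l) f.
Proof. by move=> l0 Gf fl x; apply/(refinementP _ rhoP l0) => y; exists (f y). Qed.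

Lemma refinement_convex x : convex_set (refinement rho F l1 x).
Proof.
apply: convex_bigcap => z; apply: minkowski_square_convex.
  exact: escale_rho_ge0.
by have [_ cF _] := FP z.
Qed.

Lemma refinement_closed x : closed (refinement rho F l1 x).
Proof.
apply: closed_bigI => z _; apply: minkowski_square_closed.
  exact: escale_rho_ge0.
by have [_ _ clF] := FP z.
Qed.

Lemma hull_map_rectangle z : is_rectangle (hull_map rho F l1 z).
Proof. by have [] := rect_hull_smallest (refinement_convex (x := z)). Qed.

Let T := hull_refinement rho F l1 l2.

Section Success.
Hypothesis refinement0 : forall x, refinement rho F l1 x !=set0.
Hypothesis T0 : forall x, T x !=set0.

Lemma T_rectangle x : is_rectangle (T x).
Proof. exact: hull_refinement_rectangle hull_map_rectangle _. Qed.

Lemma closed_closure_T x : closed (closure (T x)).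
Proof. exact: closed_closure. Qed.

Lemma closure_T0 x : closure (T x) !=set0.
Proof. by have [p Tp] := T0 x; exists p; exact: subset_closure. Qed.

Lemma closure_T_rectangular x : rectangular (closure (T x)).
Proof. exact: (closure_rectangular (rectangle_rectangular (T_rectangle x))). Qed.

Lemma nearest_compact x : compact (nearest_to_origin rho F l1 l2 x).
Proof. by apply: nearest_to_0_compact; [exact: closed_closure_T|exact: closure_T0]. Qed.

Lemma nearest0 x : nearest_to_origin rho F l1 l2 x !=set0.
Proof. exact: (metric_proj_exists 0 (@closed_closure_T _) (closure_T0 x)). Qed.

Lemma nearest_rectangular x : rectangular (nearest_to_origin rho F l1 l2 x).
Proof.
exact: (nearest_to_0_rectangular (@closed_closure_T _) (closure_T0 x)
  (closure_T_rectangular (x := x))).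
Qed.

(** The term of index [x] in the intersection defining [T x] is the rectangular
    hull of the refinement at [x] itself, as [rho x x = 0]. *)
Lemma center_map_near_hull x : near_hull (refinement rho F l1 x) (center_map rho F l1 l2 x).
Proof.
apply: closure_rect_hull.
have [clT _] := center_in (@nearest_compact x) (nearest0 x) (nearest_rectangular (x := x)).
apply: (closureS _ clT) => p; exact: (refinement_sub rhoP l20).
Qed.

Lemma center_map_lip x y d : rho x y = d%:E ->
  `|center_map rho F l1 l2 x - center_map rho F l1 l2 y| <= l2 * d.
Proof.
have [rho0 _ rhoC _] := rhoP.
have dom u v (e : R) : rho u v = e%:E -> dominated_by (l2 * e) (closure (T u)) (closure (T v)).
  move=> uv; apply/closure_dominated.
  by apply: (hull_refinement_dominated rhoP l20 hull_map_rectangle uv); exact: T0.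
move=> xy; have yx : rho y x = d%:E by rewrite rhoC.
have d0 : 0 <= l2 * d by rewrite mulr_ge0 // -lee_fin -xy.
have ndom u v : rho u v = d%:E -> rho v u = d%:E -> dominated_by (l2 * d)
    (nearest_to_origin rho F l1 l2 u) (nearest_to_origin rho F l1 l2 v).
  move=> uv vu; apply: (nearest_to_0_dominated (@closed_closure_T _)
    (closure_T0 v) (closure_T_rectangular (x := v)) d0); exact: dom.
exact: (center_close (@nearest_compact x) (@nearest_compact y) (nearest0 x)
  (nearest0 y) (nearest_rectangular (x := x)) (nearest_rectangular (x := y))
  (ndom _ _ xy yx) (ndom _ _ yx xy)).
Qed.

Lemma projection_map_nearest x : metric_proj (center_map rho F l1 l2 x)
  (refinement rho F l1 x) (projection_map rho F l1 l2 x).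
Proof.
by apply: getPex; apply: metric_proj_exists; [exact: refinement_closed|exact: refinement0].
Qed.

Lemma projection_map_lip x y : (`|projection_map rho F l1 l2 x - projection_map rho F l1 l2 y|%:E
  <= escale (l1 + 2 * l2) (rho x y))%E.
Proof.
have [rho0 _ rhoC _] := rhoP; have := rho0 x y.
case xy : (rho x y) => [d| |] // d0; last by rewrite leey.
rewrite lee_fin in d0; have yx : rho y x = d%:E by rewrite rhoC.
rewrite lee_fin mulrDl -mulrA.
have F0 z : F z !=set0 by have [] := FP z.
have cA z w : convex_set (minkowski_sum (F w) (square (escale l1 (rho z w)))).
  by apply: minkowski_square_convex; [exact: escale_rho_ge0|have [] := FP w].
apply: (nearest_points_close _ _ (cA x) (cA y)
  (enlargements_close rhoP l10 F0 xy) (enlargements_close rhoP l10 F0 yx)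
  (center_map_lip xy) (center_map_near_hull x) (center_map_near_hull y)
  (projection_map_nearest x) (projection_map_nearest y)); exact: mulr_ge0.
Qed.

End Success.
End Algorithm.

Unset Implicit Arguments.

Theorem theorem6p3 (R : realType) (l1 l2 : R) (M : Type)
    (rho : M -> M -> \bar R) (F : M -> set (R * R)) :
  0 <= l1 -> 0 <= l2 ->
  is_pseudometric rho ->
  (forall x, conv_family (F x)) ->
  (finite_set [set: M] \/
   exists (alpha : R) (m : nat) (xbar : 'I_m -> M),
     [/\ 0 <= alpha,
         \bigcap_k minkowski_sum (F (xbar k)) (square alpha%:E) !=set0
       & bounded_set (\bigcap_k minkowski_sum (F (xbar k)) (square alpha%:E))]) ->
  (projection_algorithm rho F l1 l2 = NoGo ->
     ~ exists f : M -> R * R, lip_selection rho F f /\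
         (lip_seminorm rho f <= (Num.min l1 l2)%:E)%E) /\
  (projection_algorithm rho F l1 l2 <> NoGo ->
     exists f : M -> R * R,
     [/\ projection_algorithm rho F l1 l2 = Success f,
         f = projection_map rho F l1 l2,
         (forall x,
            [/\ refinement rho F l1 x !=set0,
                is_rectangle (hull_refinement rho F l1 l2 x),
                hull_refinement rho F l1 l2 x !=set0,
                has_center (nearest_to_origin rho F l1 l2 x)
              & exists p, metric_proj (center_map rho F l1 l2 x)
                                      (refinement rho F l1 x) = [set p]])
       & lip_selection rho F f /\
         (lip_seminorm rho f <= (l1 + 2 * l2)%:E)%E]).
Proof.
move=> l10 l20 rhoP FP _; rewrite /projection_algorithm; split.
  move=> nogo [f [[Ff _] flip]].
  have lip l : Num.min l1 l2 <= l -> forall x y, (`|f x - f y|%:E <= escale l (rho x y))%E.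
    move=> ml; apply: lip_seminorm_bound => //.
    by apply: le_trans flip _; rewrite lee_fin.
  have f1 : is_selection (refinement rho F l1) f.
    by apply: lip_selection_refines => //; apply: lip; rewrite ge_min lexx.
  have f2 : is_selection (hull_refinement rho F l1 l2) f.
    apply: lip_selection_refines => //; last by apply: lip; rewrite ge_min lexx orbT.
    by move=> x; split; exists (f x).
  move: nogo; case: asboolP => [[x Fx] _|_]; first by have := f1 x; rewrite Fx.
  by case: asboolP => // -[x Tx]; have := f2 x; rewrite Tx.
case: asboolP => // ne1; case: asboolP => // ne2 _.
have F10 x : refinement rho F l1 x !=set0.
  by apply: contrapT => /nonemptyPn Fx; apply: ne1; exists x.
have T0 x : hull_refinement rho F l1 l2 x !=set0.
  by apply: contrapT => /nonemptyPn Tx; apply: ne2; exists x.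
have lipc : lip_constants rho (projection_map rho F l1 l2) (l1 + 2 * l2).
  by split; [rewrite addr_ge0 // mulr_ge0|move=> x y; apply: projection_map_lip].
exists (projection_map rho F l1 l2); split=> //.
  move=> x; split=> //; first exact: T_rectangle.
    apply: has_center_compact; [exact: nearest_compact|exact: nearest0|].
    exact: nearest_rectangular.
  exists (projection_map rho F l1 l2 x); apply/seteqP.
  have pP := projection_map_nearest l2 rhoP l10 FP F10 x.
  split=> [p pP'|_ ->] //=.
  have := center_map_near_hull rhoP l10 l20 FP T0 x.
  by move/(metric_proj_unique (refinement_convex rhoP l10 FP (x := x))); apply.
split; last by apply: ereal_inf_lbound; exists (l1 + 2 * l2).
split; last by exists (l1 + 2 * l2).
by move=> x; have [/(refinement_sub rhoP l10)] := projection_map_nearest l2 rhoP l10 FP F10 x.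
Qed.
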